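(* Let $(a_n)_{n\ge 1}$ be an infinite PLP sequence and let $s\ge 2$ be an integer. If $\sum_{n=1}^\infty \frac{1}{a_n}>P(s)$ (where a divergent series is regarded as having sum $+\infty$), then there is a $k\ge 1$ such that $a_k$ has at most $s-1$ prime factors, counted with multiplicity. In particular, if $\sum_{n=1}^\infty \frac{1}{a_n}>P(2)$, then there is at least one natural number $k\ge 1$ for which $a_k$ is prime.
   Context: A sequence of natural numbers is called a PLP sequence if it is strictly increasing, its terms are pairwise relatively prime, and all its terms are greater than $1$. The prime zeta function is $P(s)=\sum_{p}\frac{1}{p^s}$, where the sum runs over all prime numbers $p$. *)

(* Defs.v *)
From mathcomp Require Import all_boot all_order all_algebra.
From mathcomp Require Import all_classical all_reals all_analysis.

Set Implicit Arguments.
Unset Strict Implicit.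
Unset Printing Implicit Defensive.

Import Order.TTheory GRing.Theory Num.Theory.

(* Infinite PLP sequences, indexed from 0: [a n] stands for a_{n+1}. *)
Definition PLP (a : nat -> nat) : Prop :=
  [/\ {homo a : i j / (i < j)%N},
      forall i j : nat, i != j -> coprime (a i) (a j)
    & forall n : nat, (1 < a n)%N].

Definition num_prime_factors (n : nat) : nat := (\sum_(p <- primes n) logn p n)%N.

(* Extended-real sums of nonnegative terms, so +oo is the value of a divergent
   series. *)
Definition prime_zeta (R : realType) (s : nat) : \bar R :=
  (\sum_(0 <= p <oo | prime p) ((p%:R ^+ s)^-1 : R)%:E)%E.

Definition reciprocal_sum (R : realType) (a : nat -> nat) : \bar R :=
  (\sum_(0 <= n <oo) ((a n)%:R^-1 : R)%:E)%E.

(* Main.v *)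
Require Import Defs.
From mathcomp Require Import all_boot all_order all_algebra.
From mathcomp Require Import all_classical all_reals all_analysis.

(** The argument is by contraposition.  Suppose every term [a n] has at least
    [s] prime factors, counted with multiplicity, and let [p n] be its least
    prime factor.  Each of those factors is at least [p n], so
    [p n ^ s <= a n] ([pdiv_exp_num_prime_factors_le]) and hence
    [1 / a n <= 1 / p n ^ s].  Terms that are pairwise coprime share no prime,
    so the [p n] are distinct ([pdiv_coprime_inj]).  The sum of the
    [1 / p n ^ s] is therefore a sum over a subset of the primes, which is at
    most [P(s)] because a sum of nonnegative terms does not depend on their
    order and grows with the index set ([nneseries_injective_le]).  Thus
    [\sum 1 / a n <= P(s)] ([reciprocal_sum_le_prime_zeta]).

    For [s = 2] the term obtained has at most one prime factor; being larger
    than 1, it is prime ([prime_num_prime_factors_le1]). *)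

Import Order.TTheory GRing.Theory Num.Theory.

Lemma prod_primes_logn (n : nat) (n_gt0 : (0 < n)%N) :
  n = (\prod_(p <- primes n) p ^ logn p n)%N.
Proof. by rewrite {1}(prod_prime_decomp n_gt0) prime_decompE big_map. Qed.

(** Replacing every prime in the factorization of [n] by the least one can only
    decrease the product. *)
Lemma pdiv_exp_num_prime_factors_le (n : nat) (n_gt0 : (0 < n)%N) :
  (pdiv n ^ num_prime_factors n <= n)%N.
Proof.
rewrite [leqRHS](prod_primes_logn n n_gt0) /num_prime_factors.
rewrite expn_sum [leqLHS]big_seq [leqRHS]big_seq.
apply: leq_prod => p; rewrite mem_primes => /and3P[p_prime _ p_dvd].
by rewrite leq_exp2r ?logn_gt0 ?mem_primes ?p_prime ?n_gt0// pdiv_min_dvd ?prime_gt1.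
Qed.

(** Each prime divisor contributes at least 1 to the count, so there is just
    one, with exponent 1. *)
Lemma prime_num_prime_factors_le1 (n : nat) :
  (1 < n)%N -> (num_prime_factors n <= 1)%N -> prime n.
Proof.
move=> n_gt1; have n_gt0 := ltnW n_gt1.
have logn_ge1 p : p \in primes n -> (1 <= logn p n)%N by rewrite logn_gt0.
have := prod_primes_logn n n_gt0; rewrite /num_prime_factors.
case def_primes: (primes n) logn_ge1 => [|p [|q ps]] logn_ge1.
- by rewrite big_nil => n1; rewrite n1 in n_gt1.
- have p_prime : prime p.
    by have := mem_head p [::]; rewrite -def_primes mem_primes => /andP[].
  rewrite !big_seq1 => n_eq logn_le1.
  suff logn1 : logn p n = 1 by rewrite n_eq logn1 expn1.
  by apply/eqP; rewrite eqn_leq logn_le1 logn_ge1 ?mem_head.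
- move=> _; rewrite !big_cons addnA => /(leq_trans (leq_addr _ _)).
  rewrite leqNgt -addn1 leq_add// logn_ge1 ?inE ?eqxx ?orbT//.
Qed.

(** A common value of [pdiv] at two coprime terms would divide their gcd, 1. *)
Lemma pdiv_coprime_inj (a : nat -> nat) :
    (forall i j : nat, i != j -> coprime (a i) (a j)) ->
    (forall n : nat, (1 < a n)%N) ->
  injective (fun n => pdiv (a n)).
Proof.
move=> a_coprime a_gt1 i j eq_pdiv; apply/eqP/negPn/negP => neq_ij.
have p_dvd : (pdiv (a i) %| gcdn (a i) (a j))%N.
  by rewrite dvdn_gcd pdiv_dvd/= eq_pdiv pdiv_dvd.
have := prime_gt1 (pdiv_prime (a_gt1 i)).
by move: p_dvd; rewrite (eqP (a_coprime _ _ neq_ij)) dvdn1 => /eqP ->.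
Qed.

(** Both series are unordered sums, since their terms are nonnegative; along an
    injection the left one is the unordered sum of [u] over the range of [e],
    so each of its finite subsums is also a finite subsum of the right one. *)
Lemma nneseries_injective_le (R : realType) (u : nat -> \bar R) (P : pred nat)
    (e : nat -> nat) :
    (forall n, (0 <= u n)%E) -> injective e -> (forall n, P (e n)) ->
  (\sum_(0 <= n <oo) u (e n) <= \sum_(0 <= m <oo | P m) u m)%E.
Proof.
move=> u_ge0 e_inj Pe; rewrite nneseries_esumT// nneseries_esum//.
rewrite -(@esum_image _ _ _ setT e); last by move=> i j _ _ /e_inj.
apply: ge_ereal_sup => _ [X [X_fin X_sub] <-].
apply: esum_ge; exists X => //; split=> // x /X_sub [n _ <-]; exact: Pe.
Qed.

(** The contrapositive bound: compare [1 / a n] with [1 / p ^ s] for [p] the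
    least prime factor of [a n]. *)
Lemma reciprocal_sum_le_prime_zeta (R : realType) (a : nat -> nat) (s : nat) :
    PLP a -> (forall k, (s <= num_prime_factors (a k))%N) ->
  (reciprocal_sum R a <= prime_zeta R s)%E.
Proof.
case=> _ a_coprime a_gt1 a_factors.
have a_gt0 k : (0 < a k)%N := ltnW (a_gt1 k).
apply: (@le_trans _ _
  (\sum_(0 <= n <oo) (((pdiv (a n))%:R ^+ s)^-1 : R)%:E)%E).
- apply: lee_nneseries => [k _ _|k _]; first by rewrite lee_fin invr_ge0.
  rewrite lee_fin lef_pV2 ?posrE ?exprn_gt0 ?ltr0n ?pdiv_gt0// -natrX ler_nat.
  apply: leq_trans (pdiv_exp_num_prime_factors_le _ (a_gt0 k)).
  by rewrite leq_pexp2l ?pdiv_gt0.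
- apply: (@nneseries_injective_le _ (fun p => ((p%:R ^+ s)^-1 : R)%:E)).
  + by move=> p; rewrite lee_fin invr_ge0 exprn_ge0.
  + exact: pdiv_coprime_inj.
  + by move=> k; rewrite pdiv_prime.
Qed.

Lemma few_prime_factors (R : realType) (a : nat -> nat) (s : nat) :
    PLP a -> (prime_zeta R s < reciprocal_sum R a)%E ->
  exists k, (num_prime_factors (a k) < s)%N.
Proof.
move=> ha; rewrite ltNge => /negP sum_gt; apply: contrapT => no_k.
apply: sum_gt; apply: reciprocal_sum_le_prime_zeta => // k.
by rewrite leqNgt; apply/negP => k_lt; apply: no_k; exists k.
Qed.

Theorem proposition3p3 (R : realType) (a : nat -> nat) (ha : PLP a) :
  (forall s : nat, (2 <= s)%N ->
     (prime_zeta R s < reciprocal_sum R a)%E ->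
     exists k : nat, (num_prime_factors (a k) <= s - 1)%N) /\
  ((prime_zeta R 2 < reciprocal_sum R a)%E ->
     exists k : nat, prime (a k)).
Proof.
split=> [s s_ge2|] /(few_prime_factors _ _ _ ha)[k k_lt]; exists k.
- by rewrite subn1 -ltnS prednK ?(ltnW s_ge2).
- by case: ha => _ _ a_gt1; apply: prime_num_prime_factors_le1.
Qed.
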